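(* Let $z=r\mathrm{e}^{i\theta}$ with $r>0$, $|\theta|<\pi/4$, let $H$ be the operator $(Hf)(x)=-f''(x)+z^4x^2f(x)$ in $L^2(\mathbf{R})$, and let $P_n$ be its $n$th spectral projection. Then \[ \liminf_{n\to\infty}n^{-1}\log\|P_n\|\ge\log(\sec 2\theta). \]
   Context: $H$ has eigenvalues $\lambda_n=z^2(2n+1)$ and eigenfunctions $\phi_n(x)=k_n\mathrm{e}^{-z^2x^2/2}H_n(zx)$ ($H_n$ the Hermite polynomials), with constants $k_n$ chosen so that $\int_{\mathbf{R}}\phi_n(x)^2\,\mathrm{d}x=1$ (no complex conjugate). The spectral projection is $P_nf=\big(\int_{\mathbf{R}}f\phi_n\,\mathrm{d}x\big)\phi_n$, so that $\|P_n\|=\int_{\mathbf{R}}|\phi_n|^2\,\mathrm{d}x$. *)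

(* Defs.v *)
From Stdlib Require Import Reals.
From Coquelicot Require Import Coquelicot.
Open Scope R_scope.

Definition cexp (w : C) : C := (exp (Re w) * cos (Im w), exp (Re w) * sin (Im w)).

Fixpoint hermite (n : nat) (w : C) : C :=
  match n with
  | O => RtoC 1
  | S O => Cmult (RtoC 2) w
  | S (S k as m) =>
      Cminus (Cmult (Cmult (RtoC 2) w) (hermite m w))
             (Cmult (RtoC (2 * INR m)) (hermite k w))
  end.

Definition zpar (r theta : R) : C := (r * cos theta, r * sin theta).

(** Unnormalised eigenfunction g_n(x) = e^{-z^2 x^2 / 2} H_n(z x);
    phi_n = k_n g_n. *)
Definition gfun (r theta : R) (n : nat) (x : R) : C :=
  let z := zpar r theta in
  Cmult (cexp (Cmult (RtoC (- x ^ 2 / 2)) (Cmult z z))) (hermite n (Cmult z (RtoC x))).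

Definition int_R {V : CompleteNormedModule R_AbsRing} (f : R -> V) : V :=
  RInt_gen f (Rbar_locally m_infty) (Rbar_locally p_infty).

(** ||P_n|| = \int |phi_n|^2 with phi_n = k_n g_n and k_n^2 \int g_n^2 = 1
    (bilinear normalisation, no conjugate); hence
    ||P_n|| = |k_n|^2 \int |g_n|^2 = (\int |g_n|^2) / |\int g_n^2|. *)
Definition normP (r theta : R) (n : nat) : R :=
  int_R (fun x => Cmod (gfun r theta n x) ^ 2)
  / Cmod (int_R (V := C_R_CompleteNormedModule) (fun x => Cmult (gfun r theta n x) (gfun r theta n x))).

(* Main.v *)
Require Import Defs.
From Stdlib Require Import Reals Lra Lia Factorial.
From Coquelicot Require Import Coquelicot.
Open Scope R_scope.

(** For complex [u], [v] with [Re (v^2) > 0] put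
    [T m n = int exp (- v^2 x^2) H_m (u x) H_n (v x) dx]. Integration by parts gives
    [T (m+1) (n+1) = 2 (m+1) (u / v) T m n], hence
    [T n n = 2^n n! (u / v)^n int exp (- v^2 x^2) dx].
    With [u = v = z] this evaluates [int g_n^2]. For [int |g_n|^2], let
    [a = Re (z^2) = r^2 cos (2 theta)], [s = sqrt a], [k = (z / s)^n]; integrating
    [0 <= exp (- a x^2) |H_n (z x) - k H_n (s x)|^2] and using the cases [(u, v) = (z, s)] and
    [(s, s)] gives [int |g_n|^2 >= |k|^2 2^n n! int exp (- a x^2) dx], where
    [|k|^2 = (sec (2 theta))^n]. So [||P_n|| >= c (sec (2 theta))^n], with [c > 0] once the
    complex Gaussian integral is known to be nonzero, which [flux] below provides. *)

(** * Improper integrals over the line *)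

Definition int_line (f : R -> R) (l : R) : Prop :=
  is_RInt_gen f (Rbar_locally m_infty) (Rbar_locally p_infty) l.

(** The majorant [K / (1 + x ^ 2)] has the bounded primitive [K * atan x], so this one condition
    yields both convergence of the integral and decay at both ends. *)
Definition lorentz_bounded (f : R -> R) : Prop :=
  exists K, forall x, Rabs (f x) <= K / (1 + x ^ 2).

Lemma is_lim_atan_p_infty : is_lim atan p_infty (PI / 2).
Proof.
apply is_lim_ext_loc with (fun x => PI / 2 - atan (/ x)).
  exists 0; intros x Hx; rewrite (atan_inv x Hx); ring.
evar_last.
  apply is_lim_minus'.
    apply is_lim_const.
  apply (is_lim_comp_continuous (fun x => / x) atan p_infty 0).
    apply (is_lim_inv (fun x => x) p_infty p_infty); [apply is_lim_id | easy].
  apply continuity_pt_filterlim.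
  apply derivable_continuous_pt, derivable_pt_atan.
simpl; rewrite atan_0; apply f_equal; ring.
Qed.

Lemma is_lim_atan_m_infty : is_lim atan m_infty (- (PI / 2)).
Proof.
apply is_lim_ext with (fun x => - atan (- x)).
  intros x; rewrite atan_opp; ring.
apply (is_lim_opp (fun x => atan (- x)) m_infty (PI / 2)).
apply (is_lim_comp atan Ropp m_infty (PI / 2) p_infty).
- apply is_lim_atan_p_infty.
- apply (is_lim_opp (fun x => x) m_infty m_infty), is_lim_id.
- exists 0; easy.
Qed.

Lemma ex_RInt_cont (f : R -> R) (a b : R) :
  (forall x, continuous f x) -> ex_RInt f a b.
Proof. intros Hf; apply (ex_RInt_continuous (V := R_CompleteNormedModule)); auto. Qed.

Lemma is_RInt_cont (f : R -> R) (a b : R) :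
  (forall x, continuous f x) -> is_RInt f a b (RInt f a b).
Proof.
intros Hf; apply (RInt_correct (V := R_CompleteNormedModule)), ex_RInt_cont, Hf.
Qed.

Lemma is_RInt_lorentz (K a b : R) :
  is_RInt (fun x => K / (1 + x ^ 2)) a b (K * atan b - K * atan a).
Proof.
apply (is_RInt_derive (fun x => K * atan x)).
- intros x _; auto_derive; [easy | ].
  unfold Rsqr; field; nra.
- intros x _; apply (ex_derive_continuous (fun x => K / (1 + x ^ 2))).
  auto_derive; nra.
Qed.

Lemma lorentz_const_ge_0 (f : R -> R) (K : R) :
  (forall x, Rabs (f x) <= K / (1 + x ^ 2)) -> 0 <= K.
Proof.
intros Hf; generalize (Hf 0) (Rabs_pos (f 0)).
replace (K / (1 + 0 ^ 2)) with K by field; lra.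
Qed.

(** The absolute value of the [atan] difference makes the bound valid for endpoints in either order,
    as the Cauchy argument below requires. *)
Lemma RInt_lorentz_bound (f : R -> R) (K a b : R) :
  (forall x, continuous f x) -> (forall x, Rabs (f x) <= K / (1 + x ^ 2)) ->
  Rabs (RInt f a b) <= K * Rabs (atan b - atan a).
Proof.
intros Hc Hf.
assert (Hle : forall a b, a <= b -> Rabs (RInt f a b) <= K * Rabs (atan b - atan a)).
{ intros u v Huv.
  apply Rle_trans with (K * atan v - K * atan u).
    apply (norm_RInt_le f (fun x => K / (1 + x ^ 2)) u v); auto.
      apply (is_RInt_cont f u v Hc).
    apply is_RInt_lorentz.
  assert (HK := lorentz_const_ge_0 f K Hf).
  generalize (Rle_abs (atan v - atan u)); nra. }
destruct (Rle_or_lt a b) as [Hab | Hab]; [auto | ].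
rewrite <- (opp_RInt_swap f b a); [ | apply (ex_RInt_cont f b a Hc)].
unfold opp; simpl; rewrite Rabs_Ropp, (Rabs_minus_sym (atan b)).
apply Hle; lra.
Qed.

Lemma ex_int_line (f : R -> R) :
  (forall x, continuous f x) -> lorentz_bounded f -> exists l, int_line f l.
Proof.
intros Hc [K HK].
assert (HK0 := lorentz_const_ge_0 f K HK).
assert (Hcauchy : exists l : R, filterlim (fun ab => RInt f (fst ab) (snd ab))
   (filter_prod (Rbar_locally m_infty) (Rbar_locally p_infty)) (locally l)).
{ apply (filterlim_locally_cauchy (U := R_CompleteSpace)).
  intros eps.
  (* Each of the two end pieces will cost at most [K * (2 * e)], in total [4 * K * e < eps]. The
     [+ 1] keeps the denominator positive when [K = 0]. *)
  assert (He : 0 < eps / (4 * (K + 1))).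
  { apply Rdiv_lt_0_compat; [apply cond_pos | lra]. }
  set (e := mkposreal _ He).
  assert (HP := proj1 (filterlim_locally _ _) is_lim_atan_p_infty e).
  assert (HM := proj1 (filterlim_locally _ _) is_lim_atan_m_infty e).
  exists (fun ab => ball (- (PI / 2)) e (atan (fst ab)) /\ ball (PI / 2) e (atan (snd ab))).
  split.
    apply (Filter_prod _ _ _ _ _ HM HP); easy.
  intros [a b] [a' b'] [H1 H2] [H3 H4].
  revert H1 H2 H3 H4; unfold ball; simpl; unfold AbsRing_ball; simpl.
  unfold minus, plus, opp, abs; simpl; intros H1 H2 H3 H4.
  replace (RInt f a' b' + - RInt f a b) with (RInt f a' a + RInt f b b').
    eapply Rle_lt_trans; [apply Rabs_triang | ].
    assert (B1 := RInt_lorentz_bound f K a' a Hc HK).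
    assert (B2 := RInt_lorentz_bound f K b b' Hc HK).
    assert (B3 : Rabs (atan a - atan a') <= 2 * e).
    { apply Rabs_def2 in H1; apply Rabs_def2 in H3; apply Rabs_le; simpl in *; lra. }
    assert (B4 : Rabs (atan b' - atan b) <= 2 * e).
    { apply Rabs_def2 in H2; apply Rabs_def2 in H4; apply Rabs_le; simpl in *; lra. }
    assert (E : 4 * (K + 1) * e = eps) by (simpl; field; lra).
    assert (0 < e) by apply cond_pos.
    nra.
  generalize (RInt_Chasles f a' a b' (ex_RInt_cont _ _ _ Hc) (ex_RInt_cont _ _ _ Hc)).
  generalize (RInt_Chasles f a b b' (ex_RInt_cont _ _ _ Hc) (ex_RInt_cont _ _ _ Hc)).
  unfold plus; simpl; lra. }
destruct Hcauchy as [l Hl].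
exists l; unfold int_line, is_RInt_gen.
intros P HP; specialize (Hl P HP); unfold filtermap, filtermapi in *.
revert Hl; apply filter_imp; intros [a b] H.
exists (RInt f a b); split; [ | exact H].
apply (is_RInt_cont _ _ _ Hc).
Qed.

(** Restricting the two-ended limit to symmetric intervals gives an ordinary limit in one variable,
    from which uniqueness, positivity and the half-line integral of an even function are read
    off. *)
Lemma int_line_sym_lim (f : R -> R) (l : R) :
  int_line f l -> is_lim (fun t => RInt f (- t) t) p_infty l.
Proof.
intros Hf P HP.
destruct (Hf P HP) as [Q1 Q2 [M1 HM1] [M2 HM2] HQ].
exists (Rmax (- M1) M2); intros t Ht.
assert (T1 : - t < M1) by (generalize (Rmax_l (- M1) M2); lra).
assert (T2 : M2 < t) by (generalize (Rmax_r (- M1) M2); lra).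
destruct (HQ (- t) t (HM1 _ T1) (HM2 _ T2)) as [y [Hy HPy]]; simpl in Hy.
now rewrite (is_RInt_unique _ _ _ _ Hy).
Qed.

Lemma int_line_unique (f : R -> R) (l l' : R) :
  int_line f l -> int_line f l' -> l = l'.
Proof.
intros H H'; generalize (is_lim_unique _ _ _ (int_line_sym_lim _ _ H)).
rewrite (is_lim_unique _ _ _ (int_line_sym_lim _ _ H')); congruence.
Qed.

Lemma int_line_ext (f g : R -> R) (l : R) :
  (forall x, f x = g x) -> int_line f l -> int_line g l.
Proof.
intros E; apply is_RInt_gen_ext; apply filter_forall; intros; apply E.
Qed.

Lemma int_line_plus (f g : R -> R) (lf lg : R) :
  int_line f lf -> int_line g lg -> int_line (fun x => f x + g x) (lf + lg).
Proof. apply (is_RInt_gen_plus f g). Qed.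

Lemma int_line_scal (f : R -> R) (k l : R) :
  int_line f l -> int_line (fun x => k * f x) (k * l).
Proof. apply (is_RInt_gen_scal f k). Qed.

Lemma int_line_ge_0 (f : R -> R) (l : R) :
  (forall x, continuous f x) -> (forall x, 0 <= f x) -> int_line f l -> 0 <= l.
Proof.
intros Hc Hf Hl.
change (Rbar_le 0 l).
apply (is_lim_le_loc (fun _ => 0) (fun t => RInt f (- t) t) p_infty).
- exists 0; intros t Ht.
  apply RInt_ge_0; [lra | apply (ex_RInt_cont _ _ _ Hc) | auto].
- apply is_lim_const.
- now apply int_line_sym_lim.
Qed.

Lemma lorentz_bounded_lim (f : R -> R) :
  lorentz_bounded f -> is_lim f p_infty 0 /\ is_lim f m_infty 0.
Proof.
intros [K HK].
assert (HK0 := lorentz_const_ge_0 f K HK).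
(* Beyond the threshold [K < eps * |x|], and [|x| <= 1 + x ^ 2]. *)
assert (Hsmall : forall eps : posreal, forall x, K / eps + 1 < Rabs x -> Rabs (f x - 0) < eps).
{ intros eps x Hx.
  assert (Heps := cond_pos eps).
  rewrite Rminus_0_r; eapply Rle_lt_trans; [apply HK | ].
  apply (Rmult_lt_reg_r (1 + x ^ 2)); [nra | ].
  unfold Rdiv at 1; rewrite Rmult_assoc, Rinv_l, Rmult_1_r by nra.
  rewrite <- (pow2_abs x).
  assert (0 <= K / eps) by (apply Rdiv_le_0_compat; lra).
  assert (K < eps * Rabs x).
  { apply Rlt_le_trans with (eps * (K / eps + 1)).
      replace (eps * (K / eps + 1)) with (K + eps) by (field; lra); lra.
    apply Rmult_le_compat_l; lra. }
  assert (Rabs x <= 1 + Rabs x ^ 2) by nra.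
  nra. }
split; apply is_lim_spec; simpl; intros eps.
- exists (K / eps + 1); intros x Hx; apply Hsmall.
  generalize (Rle_abs x); lra.
- exists (- (K / eps + 1)); intros x Hx; apply Hsmall.
  rewrite <- Rabs_Ropp; generalize (Rle_abs (- x)); lra.
Qed.

(** The fundamental theorem of calculus with vanishing boundary values; this is the form in which
    integration by parts is used. *)
Lemma int_line_derive (F f : R -> R) :
  (forall x, is_derive F x (f x)) -> (forall x, continuous f x) ->
  lorentz_bounded F -> int_line f 0.
Proof.
intros HF Hf HB; destruct (lorentz_bounded_lim F HB) as [Hp Hm].
apply int_line_ext with (Derive F).
  intros x; apply is_derive_unique, HF.
replace 0 with (0 - 0) by ring.
apply is_RInt_gen_Derive; [ | | exact Hm | exact Hp]; apply filter_forall; intros [a b] x _.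
- exists (f x); apply HF.
- apply (continuous_ext f); [ | apply Hf].
  intros y; symmetry; apply is_derive_unique, HF.
Qed.

Lemma int_R_of_int_line (f : R -> R) (l : R) :
  int_line f l -> int_R f = l.
Proof. apply (is_RInt_gen_unique (V := R_CompleteNormedModule)). Qed.

(** Neighbourhoods in [C] contain products of real balls, so the limits of the two components can be
    taken simultaneously. *)
Lemma int_R_of_int_line_C (f : R -> C) (l : C) :
  int_line (fun x => Re (f x)) (Re l) -> int_line (fun x => Im (f x)) (Im l) ->
  int_R (V := C_R_CompleteNormedModule) f = l.
Proof.
intros H1 H2; apply (is_RInt_gen_unique (V := C_R_CompleteNormedModule)).
intros P [eps HP].
assert (K1 := H1 _ (locally_ball (Re l) eps)).
assert (K2 := H2 _ (locally_ball (Im l) eps)).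
unfold filtermapi in K1, K2.
generalize (filter_and _ _ K1 K2); unfold filtermapi; apply filter_imp.
intros [a b] [[y [Hy By]] [y' [Hy' By']]].
exists (y, y'); split.
- apply (is_RInt_fct_extend_pair (U := R_NormedModule) (V := R_NormedModule) f a b y y' Hy Hy').
- apply HP; split; assumption.
Qed.

(** * Complex-valued functions of a real variable *)

(** Componentwise, so that real calculus applies to each part while derivatives are still compared
    by complex [ring] identities. *)
Definition is_derive_RC (f : R -> C) (x : R) (l : C) : Prop :=
  is_derive (fun t => Re (f t)) x (Re l) /\ is_derive (fun t => Im (f t)) x (Im l).

Definition int_line_C (f : R -> C) (l : C) : Prop :=
  int_line (fun x => Re (f x)) (Re l) /\ int_line (fun x => Im (f x)) (Im l).

Definition continuous_RC (f : R -> C) : Prop :=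
  forall x, continuous (fun t => Re (f t)) x /\ continuous (fun t => Im (f t)) x.

Lemma is_derive_RC_const (c : C) (x : R) : is_derive_RC (fun _ => c) x (RtoC 0).
Proof.
split; [apply (is_derive_const (Re c)) | apply (is_derive_const (Im c))].
Qed.

Lemma is_derive_RC_id (x : R) : is_derive_RC RtoC x (RtoC 1).
Proof.
split; simpl; [apply (is_derive_id x) | apply (is_derive_const 0)].
Qed.

Lemma is_derive_RC_plus (f g : R -> C) (x : R) (lf lg : C) :
  is_derive_RC f x lf -> is_derive_RC g x lg ->
  is_derive_RC (fun t => f t + g t)%C x (lf + lg)%C.
Proof.
intros [f1 f2] [g1 g2]; split.
- apply (is_derive_plus (fun t => Re (f t)) (fun t => Re (g t)) x _ _ f1 g1).
- apply (is_derive_plus (fun t => Im (f t)) (fun t => Im (g t)) x _ _ f2 g2).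
Qed.

Lemma is_derive_RC_mult (f g : R -> C) (x : R) (lf lg : C) :
  is_derive_RC f x lf -> is_derive_RC g x lg ->
  is_derive_RC (fun t => f t * g t)%C x (lf * g x + f x * lg)%C.
Proof.
intros [f1 f2] [g1 g2]; split.
- apply (is_derive_ext (fun t => Re (f t) * Re (g t) - Im (f t) * Im (g t))).
    intros t; reflexivity.
  evar_last.
    apply (is_derive_minus (fun t => Re (f t) * Re (g t)) (fun t => Im (f t) * Im (g t))).
      apply (is_derive_mult _ _ x _ _ f1 g1); intros; apply Rmult_comm.
    apply (is_derive_mult _ _ x _ _ f2 g2); intros; apply Rmult_comm.
  unfold minus, plus, opp, mult; simpl; unfold Re, Im; ring.
- apply (is_derive_ext (fun t => Re (f t) * Im (g t) + Im (f t) * Re (g t))).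
    intros t; reflexivity.
  evar_last.
    apply (is_derive_plus (fun t => Re (f t) * Im (g t)) (fun t => Im (f t) * Re (g t))).
      apply (is_derive_mult _ _ x _ _ f1 g2); intros; apply Rmult_comm.
    apply (is_derive_mult _ _ x _ _ f2 g1); intros; apply Rmult_comm.
  unfold plus, mult; simpl; unfold Re, Im; ring.
Qed.

Lemma is_derive_RC_eq (f : R -> C) (x : R) (l l' : C) :
  is_derive_RC f x l -> l = l' -> is_derive_RC f x l'.
Proof. now intros H <-. Qed.

Lemma is_derive_RC_ext (f g : R -> C) (x : R) (l : C) :
  (forall t, f t = g t) -> is_derive_RC f x l -> is_derive_RC g x l.
Proof.
intros E [H1 H2]; split; (eapply is_derive_ext; [ | eassumption]);
  intros t; simpl; now rewrite E.
Qed.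

Lemma is_derive_RC_linear (c : C) (x : R) : is_derive_RC (fun t => c * RtoC t)%C x c.
Proof.
eapply is_derive_RC_eq.
  apply is_derive_RC_mult; [apply is_derive_RC_const | apply is_derive_RC_id].
cbv beta; ring.
Qed.

(** * Derivatives of Gaussians and Hermite polynomials *)

Definition gauss (w : C) (x : R) : C := cexp (RtoC (- x ^ 2) * w)%C.

Lemma gauss_components (a b x : R) :
  gauss (a, b) x = (exp (- (a * x ^ 2)) * cos (b * x ^ 2), - (exp (- (a * x ^ 2)) * sin (b * x ^ 2))).
Proof.
unfold gauss, cexp.
replace (RtoC (- x ^ 2) * (a, b))%C with (- (a * x ^ 2), - (b * x ^ 2)).
  unfold Re, Im, fst, snd; rewrite cos_neg, sin_neg; apply f_equal2; ring.
unfold Cmult; simpl; apply f_equal2; ring.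
Qed.

Lemma is_derive_RC_gauss (w : C) (x : R) :
  is_derive_RC (gauss w) x (- RtoC 2 * w * RtoC x * gauss w x)%C.
Proof.
destruct w as [a b]; rewrite gauss_components; split.
- apply (is_derive_ext (fun t => exp (- (a * t ^ 2)) * cos (b * t ^ 2))).
    intros t; now rewrite gauss_components.
  auto_derive; [easy | simpl; ring].
- apply (is_derive_ext (fun t => - (exp (- (a * t ^ 2)) * sin (b * t ^ 2)))).
    intros t; now rewrite gauss_components.
  auto_derive; [easy | simpl; ring].
Qed.

Lemma Cmod_cexp (w : C) : Cmod (cexp w) = exp (Re w).
Proof.
unfold Cmod, cexp; simpl.
replace (_ + _) with (exp (Re w) ^ 2 * (Rsqr (sin (Im w)) + Rsqr (cos (Im w)))) by (unfold Rsqr; ring).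
rewrite sin2_cos2, Rmult_1_r; apply sqrt_pow2, Rlt_le, exp_pos.
Qed.

Lemma Cmod_gauss (w : C) (x : R) : Cmod (gauss w x) = exp (- (Re w * x ^ 2)).
Proof.
unfold gauss; rewrite Cmod_cexp; f_equal; destruct w; simpl; ring.
Qed.

Lemma hermite_SS (n : nat) (w : C) :
  hermite (S (S n)) w = (RtoC 2 * w * hermite (S n) w - RtoC (2 * INR (S n)) * hermite n w)%C.
Proof. reflexivity. Qed.

(** The lowering relation [H_(n+1)' = 2 (n+1) H_n] with the chain rule. The recurrence has second
    order, so the induction carries two consecutive indices. *)
Lemma is_derive_RC_hermite_scal (u : C) (n : nat) (x : R) :
  is_derive_RC (fun t => hermite (S n) (u * RtoC t)%C) x
    (RtoC (2 * INR (S n)) * u * hermite n (u * RtoC x))%C.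
Proof.
revert n x.
assert (H : forall n,
  (forall x, is_derive_RC (fun t => hermite (S n) (u * RtoC t)%C) x
    (RtoC (2 * INR (S n)) * u * hermite n (u * RtoC x))%C) /\
  (forall x, is_derive_RC (fun t => hermite (S (S n)) (u * RtoC t)%C) x
    (RtoC (2 * INR (S (S n))) * u * hermite (S n) (u * RtoC x))%C)).
2: { intros n; exact (proj1 (H n)). }
(* The differentiated three-term recurrence; inserting the two known derivatives lets the recurrence
   itself reassemble the result. *)
assert (Hstep : forall m x l l',
  is_derive_RC (fun t => hermite (S m) (u * RtoC t)%C) x l ->
  is_derive_RC (fun t => hermite m (u * RtoC t)%C) x l' ->
  is_derive_RC (fun t => hermite (S (S m)) (u * RtoC t)%C) x
   (RtoC 2 * u * hermite (S m) (u * RtoC x) + RtoC 2 * (u * RtoC x) * l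
     - RtoC (2 * INR (S m)) * l')%C).
{ intros m x l l' H1 H2.
  apply (is_derive_RC_ext (fun t => RtoC 2 * (u * RtoC t) * hermite (S m) (u * RtoC t)
      + - RtoC (2 * INR (S m)) * hermite m (u * RtoC t))%C).
    intros t; rewrite hermite_SS; ring.
  eapply is_derive_RC_eq.
    apply (is_derive_RC_plus
      (fun t => RtoC 2 * (u * RtoC t) * hermite (S m) (u * RtoC t))%C
      (fun t => - RtoC (2 * INR (S m)) * hermite m (u * RtoC t))%C).
      apply is_derive_RC_mult; [ | exact H1].
      apply is_derive_RC_mult; [apply is_derive_RC_const | apply is_derive_RC_linear].
    apply is_derive_RC_mult; [apply is_derive_RC_const | exact H2].
  simpl; ring. }
assert (H1 : forall x, is_derive_RC (fun t => hermite 1 (u * RtoC t)%C) x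
    (RtoC (2 * INR 1) * u * hermite 0 (u * RtoC x))%C).
{ intros x; simpl; eapply is_derive_RC_eq.
    apply is_derive_RC_mult; [apply is_derive_RC_const | apply is_derive_RC_linear].
  rewrite Rmult_1_r; ring. }
induction n as [ | n [IH1 IH2]].
- split; [exact H1 | ].
  intros x; eapply is_derive_RC_eq.
    exact (Hstep 0%nat x _ _ (H1 x) (is_derive_RC_const _ x)).
  simpl; rewrite !RtoC_mult, RtoC_plus; ring.
- split; [exact IH2 | ].
  intros x; eapply is_derive_RC_eq.
    exact (Hstep (S n) x _ _ (IH2 x) (IH1 x)).
  rewrite (hermite_SS n), !RtoC_mult, (S_INR (S (S n))), RtoC_plus; ring.
Qed.

(** The raising relation behind Rodrigues' formula: [2 y H_n (y) - H_n' (y) = H_(n+1) (y)]. The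
    index [0] is separate because the lowering relation speaks of positive indices. *)
Lemma is_derive_RC_gauss_hermite (v : C) (n : nat) (x : R) :
  is_derive_RC (fun t => gauss (v * v) t * hermite n (v * RtoC t))%C x
    (- v * (gauss (v * v) x * hermite (S n) (v * RtoC x)))%C.
Proof.
destruct n as [ | n]; eapply is_derive_RC_eq.
- exact (is_derive_RC_mult _ _ x _ _ (is_derive_RC_gauss _ x) (is_derive_RC_const (RtoC 1) x)).
- simpl; ring.
- exact (is_derive_RC_mult _ _ x _ _ (is_derive_RC_gauss _ x) (is_derive_RC_hermite_scal v n x)).
- rewrite hermite_SS; ring.
Qed.

(** * Polynomial growth against Gaussian decay *)

Definition poly_bounded (f : R -> C) : Prop :=
  exists K k, 0 <= K /\ forall x, Cmod (f x) <= K * (1 + x ^ 2) ^ k.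

Lemma poly_bounded_const (c : C) : poly_bounded (fun _ => c).
Proof.
exists (Cmod c), 0%nat; split; [apply Cmod_ge_0 | ]; intros x; simpl; lra.
Qed.

Lemma poly_bounded_id : poly_bounded RtoC.
Proof.
exists 1, 1%nat; split; [lra | ]; intros x.
rewrite Cmod_R, Rmult_1_l, pow_1; apply Rabs_le; nra.
Qed.

Lemma poly_bounded_mult (f g : R -> C) :
  poly_bounded f -> poly_bounded g -> poly_bounded (fun x => f x * g x)%C.
Proof.
intros [K [k [HK Hf]]] [L [l [HL Hg]]].
exists (K * L), (k + l)%nat; split; [apply Rmult_le_pos; auto | intros x].
rewrite Cmod_mult, pow_add.
replace (K * L * ((1 + x ^ 2) ^ k * (1 + x ^ 2) ^ l))
  with (K * (1 + x ^ 2) ^ k * (L * (1 + x ^ 2) ^ l)) by ring.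
apply Rmult_le_compat; auto using Cmod_ge_0.
Qed.

Lemma poly_bounded_plus (f g : R -> C) :
  poly_bounded f -> poly_bounded g -> poly_bounded (fun x => f x + g x)%C.
Proof.
intros [K [k [HK Hf]]] [L [l [HL Hg]]].
exists (K + L), (k + l)%nat; split; [lra | intros x].
eapply Rle_trans; [apply Cmod_triangle | ].
specialize (Hf x); specialize (Hg x).
assert (H1 : 1 <= 1 + x ^ 2) by nra.
assert (Hk := Rle_pow _ k (k + l) H1 ltac:(lia)).
assert (Hl := Rle_pow _ l (k + l) H1 ltac:(lia)).
nra.
Qed.

Lemma poly_bounded_opp (f : R -> C) :
  poly_bounded f -> poly_bounded (fun x => - f x)%C.
Proof.
intros [K [k [HK Hf]]]; exists K, k; split; [exact HK | ].
intros x; rewrite Cmod_opp; apply Hf.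
Qed.

Lemma poly_bounded_hermite (u : C) (n : nat) :
  poly_bounded (fun x => hermite n (u * RtoC x)%C).
Proof.
assert (Hu : poly_bounded (fun x => u * RtoC x)%C).
{ apply poly_bounded_mult; [apply poly_bounded_const | apply poly_bounded_id]. }
enough (H : poly_bounded (fun x => hermite n (u * RtoC x)%C) /\
  poly_bounded (fun x => hermite (S n) (u * RtoC x)%C)) by apply H.
assert (H2u := poly_bounded_mult _ _ (poly_bounded_const (RtoC 2)) Hu).
induction n as [ | n [IH1 IH2]]; split.
- exact (poly_bounded_const (RtoC 1)).
- exact H2u.
- exact IH2.
- exact (poly_bounded_plus _ _ (poly_bounded_mult _ _ H2u IH2)
    (poly_bounded_opp _ (poly_bounded_mult _ _ (poly_bounded_const (RtoC (2 * INR (S n)))) IH1))).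
Qed.

(** The inequality [y <= exp y] at [y = b (1 + x^2)], raised to the power [k], gives [(1 + x^2)^k <=
    b^(-k) exp (k b (1 + x^2))], and [k b <= a]. *)
Lemma exp_sq_bound (a : R) (k : nat) : 0 < a ->
  exists K, 0 <= K /\ forall x, (1 + x ^ 2) ^ k * exp (- (a * x ^ 2)) <= K.
Proof.
intros Ha.
(* Dividing by [k + 1] instead of [k] covers the case [k = 0]. *)
set (b := a / INR (S k)).
assert (Hk : 0 < INR (S k)) by (apply lt_0_INR; lia).
assert (Hb : 0 < b) by (apply Rdiv_lt_0_compat; auto).
exists ((/ b) ^ k * exp a); split.
  apply Rmult_le_pos; [ | apply Rlt_le, exp_pos].
  apply pow_le, Rlt_le, Rinv_0_lt_compat, Hb.
intros x.
assert (H1 : (1 + x ^ 2) ^ k <= (/ b) ^ k * exp (a * (1 + x ^ 2))).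
{ apply Rle_trans with ((/ b * exp (b * (1 + x ^ 2))) ^ k).
    apply pow_incr; split; [nra | ].
    apply (Rmult_le_reg_l b); [exact Hb | ].
    rewrite <- Rmult_assoc, Rinv_r, Rmult_1_l by lra.
    generalize (exp_ineq1_le (b * (1 + x ^ 2))); lra.
  rewrite Rpow_mult_distr; apply Rmult_le_compat_l.
    apply pow_le, Rlt_le, Rinv_0_lt_compat, Hb.
  rewrite <- (exp_ln (exp _ ^ k)) by (apply pow_lt, exp_pos).
  rewrite ln_pow by apply exp_pos; rewrite ln_exp.
  assert (E : a = INR (S k) * b) by (unfold b; field; lra).
  destruct (Rle_lt_or_eq_dec (INR k * (b * (1 + x ^ 2))) (a * (1 + x ^ 2))) as [H | H].
  - rewrite E, S_INR; nra.
  - now apply Rlt_le, exp_increasing.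
  - rewrite H; apply Rle_refl. }
replace (exp a) with (exp (a * (1 + x ^ 2)) * exp (- (a * x ^ 2))).
  rewrite <- Rmult_assoc; apply Rmult_le_compat_r; [apply Rlt_le, exp_pos | exact H1].
rewrite <- exp_plus; f_equal; ring.
Qed.

Lemma Re_le_Cmod (c : C) : Rabs (Re c) <= Cmod c.
Proof.
generalize (Rmax_Cmod c); generalize (Rmax_l (Rabs (fst c)) (Rabs (snd c))).
unfold Re; lra.
Qed.

Lemma Im_le_Cmod (c : C) : Rabs (Im c) <= Cmod c.
Proof.
generalize (Rmax_Cmod c); generalize (Rmax_r (Rabs (fst c)) (Rabs (snd c))).
unfold Im; lra.
Qed.

Lemma gauss_poly_lorentz (w : C) (p : R -> C) :
  0 < Re w -> poly_bounded p ->
  lorentz_bounded (fun x => Re (gauss w x * p x)) /\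
  lorentz_bounded (fun x => Im (gauss w x * p x)).
Proof.
intros Hw [K [k [HK Hp]]].
(* One power beyond the growth of [p] supplies the denominator [1 + x ^ 2]. *)
destruct (exp_sq_bound (Re w) (S k) Hw) as [L [HL HLx]].
assert (H : forall x, Cmod (gauss w x * p x) <= K * L / (1 + x ^ 2)).
{ intros x; rewrite Cmod_mult, Cmod_gauss.
  apply (Rmult_le_reg_r (1 + x ^ 2)); [nra | ].
  unfold Rdiv; rewrite (Rmult_assoc (K * L)), Rinv_l, Rmult_1_r by nra.
  apply Rle_trans with (K * ((1 + x ^ 2) ^ S k * exp (- (Re w * x ^ 2)))).
    replace (K * _) with (exp (- (Re w * x ^ 2)) * (K * (1 + x ^ 2) ^ k) * (1 + x ^ 2))
      by (simpl; ring).
    apply Rmult_le_compat_r; [nra | ].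
    apply Rmult_le_compat_l; [apply Rlt_le, exp_pos | apply Hp].
  apply Rmult_le_compat_l; auto. }
split; exists (K * L); intros x; eapply Rle_trans;
  [apply Re_le_Cmod | apply H | apply Im_le_Cmod | apply H].
Qed.

Lemma ex_int_line_C_gauss (w : C) (p : R -> C) :
  0 < Re w -> continuous_RC (fun x => gauss w x * p x)%C -> poly_bounded p ->
  exists l, int_line_C (fun x => gauss w x * p x)%C l.
Proof.
intros Hw Hc Hp; destruct (gauss_poly_lorentz w p Hw Hp) as [H1 H2].
destruct (ex_int_line _ (fun x => proj1 (Hc x)) H1) as [l1 Hl1].
destruct (ex_int_line _ (fun x => proj2 (Hc x)) H2) as [l2 Hl2].
now exists (l1, l2).
Qed.

Lemma int_line_C_ext (f g : R -> C) (l : C) :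
  (forall x, f x = g x) -> int_line_C f l -> int_line_C g l.
Proof.
intros E [H1 H2]; split; eapply int_line_ext; eauto; intros x; simpl; now rewrite E.
Qed.

Lemma int_line_C_plus (f g : R -> C) (lf lg : C) :
  int_line_C f lf -> int_line_C g lg -> int_line_C (fun x => f x + g x)%C (lf + lg)%C.
Proof.
intros [f1 f2] [g1 g2]; split; [apply (int_line_plus _ _ _ _ f1 g1)
  | apply (int_line_plus _ _ _ _ f2 g2)].
Qed.

Lemma int_line_C_scal (f : R -> C) (k l : C) :
  int_line_C f l -> int_line_C (fun x => k * f x)%C (k * l)%C.
Proof.
intros [H1 H2]; split.
- apply (int_line_ext (fun x => Re k * Re (f x) + (- Im k) * Im (f x))).
    intros x; unfold Re, Im; simpl; ring.
  replace (Re (k * l)%C) with (Re k * Re l + (- Im k) * Im l)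
    by (unfold Re, Im; simpl; ring).
  apply int_line_plus; now apply int_line_scal.
- apply (int_line_ext (fun x => Re k * Im (f x) + Im k * Re (f x))).
    intros x; unfold Re, Im; simpl; ring.
  replace (Im (k * l)%C) with (Re k * Im l + Im k * Re l)
    by (unfold Re, Im; simpl; ring).
  apply int_line_plus; now apply int_line_scal.
Qed.

(** The integrand of [T m n]. The weight is tied to [v] so that the raising relation acts on the
    second Hermite factor. *)
Definition hermite_pair (u v : C) (m n : nat) (x : R) : C :=
  (gauss (v * v) x * (hermite m (u * RtoC x) * hermite n (v * RtoC x)))%C.

Lemma is_derive_RC_hermite_pair (u v : C) (m n : nat) (x : R) :
  is_derive_RC (hermite_pair u v (S m) n) x
    (RtoC (2 * INR (S m)) * u * hermite_pair u v m n x
      + - v * hermite_pair u v (S m) (S n) x)%C.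
Proof.
assert (H := is_derive_RC_mult _ _ x _ _
  (is_derive_RC_hermite_scal u m x) (is_derive_RC_gauss_hermite v n x)).
eapply is_derive_RC_eq.
  eapply is_derive_RC_ext; [ | exact H].
  intros t; unfold hermite_pair; ring.
unfold hermite_pair; ring.
Qed.

(** * Integrals of products of Hermite polynomials *)

Lemma continuous_RC_ex_derive (f : R -> C) :
  (forall x, exists l, is_derive_RC f x l) -> continuous_RC f.
Proof.
intros H x; destruct (H x) as [l [H1 H2]]; split.
- apply (ex_derive_continuous (fun t => Re (f t))); now exists (Re l).
- apply (ex_derive_continuous (fun t => Im (f t))); now exists (Im l).
Qed.

Lemma continuous_RC_mult (f g : R -> C) :
  continuous_RC f -> continuous_RC g -> continuous_RC (fun x => f x * g x)%C.
Proof.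
intros Hf Hg x; destruct (Hf x) as [f1 f2]; destruct (Hg x) as [g1 g2]; split.
- apply (continuous_minus (fun t => Re (f t) * Re (g t)) (fun t => Im (f t) * Im (g t)));
    now apply (continuous_mult (K := R_AbsRing)).
- apply (continuous_plus (fun t => Re (f t) * Im (g t)) (fun t => Im (f t) * Re (g t)));
    now apply (continuous_mult (K := R_AbsRing)).
Qed.

Lemma continuous_RC_plus (f g : R -> C) :
  continuous_RC f -> continuous_RC g -> continuous_RC (fun x => f x + g x)%C.
Proof.
intros Hf Hg x; destruct (Hf x) as [f1 f2]; destruct (Hg x) as [g1 g2]; split.
- apply (continuous_plus (fun t => Re (f t)) (fun t => Re (g t)) x f1 g1).
- apply (continuous_plus (fun t => Im (f t)) (fun t => Im (g t)) x f2 g2).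
Qed.

Lemma continuous_RC_conj (f : R -> C) :
  continuous_RC f -> continuous_RC (fun x => Cconj (f x)).
Proof.
intros Hf x; destruct (Hf x) as [f1 f2]; split; [exact f1 | ].
apply (continuous_opp (fun t => Im (f t)) x f2).
Qed.

Lemma continuous_RC_const (c : C) : continuous_RC (fun _ => c).
Proof. intros x; split; apply continuous_const. Qed.

Lemma continuous_RC_gauss (w : C) : continuous_RC (gauss w).
Proof.
apply continuous_RC_ex_derive; intros x; eexists; apply is_derive_RC_gauss.
Qed.

Lemma continuous_RC_hermite (u : C) (n : nat) :
  continuous_RC (fun x => hermite n (u * RtoC x)%C).
Proof.
apply continuous_RC_ex_derive; intros x.
destruct n as [ | n]; eexists;
  [apply (is_derive_RC_const (RtoC 1) x) | apply is_derive_RC_hermite_scal].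
Qed.

Lemma continuous_RC_hermite_pair (u v : C) (m n : nat) : continuous_RC (hermite_pair u v m n).
Proof.
apply continuous_RC_mult; [apply continuous_RC_gauss | ].
apply continuous_RC_mult; apply continuous_RC_hermite.
Qed.

(** The integrand is the derivative of [hermite_pair u v (S m) n], which decays at both ends. *)
Lemma int_line_C_derive_hermite_pair (u v : C) (m n : nat) :
  0 < Re (v * v)%C ->
  int_line_C (fun x => RtoC (2 * INR (S m)) * u * hermite_pair u v m n x
      + - v * hermite_pair u v (S m) (S n) x)%C (RtoC 0).
Proof.
intros Hv.
assert (Hc : continuous_RC (fun x => RtoC (2 * INR (S m)) * u * hermite_pair u v m n x
      + - v * hermite_pair u v (S m) (S n) x)%C).
{ exact (continuous_RC_plus _ _
    (continuous_RC_mult _ _ (continuous_RC_const _) (continuous_RC_hermite_pair u v m n))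
    (continuous_RC_mult _ _ (continuous_RC_const _) (continuous_RC_hermite_pair u v (S m) (S n)))). }
destruct (gauss_poly_lorentz (v * v)%C
  (fun x => hermite (S m) (u * RtoC x) * hermite n (v * RtoC x))%C Hv) as [B1 B2].
  apply poly_bounded_mult; apply poly_bounded_hermite.
split.
- apply (int_line_derive (fun x => Re (hermite_pair u v (S m) n x))); [ | | exact B1].
    intros x; exact (proj1 (is_derive_RC_hermite_pair u v m n x)).
  intros x; exact (proj1 (Hc x)).
- apply (int_line_derive (fun x => Im (hermite_pair u v (S m) n x))); [ | | exact B2].
    intros x; exact (proj2 (is_derive_RC_hermite_pair u v m n x)).
  intros x; exact (proj2 (Hc x)).
Qed.

Lemma Re_sqr_pos_ne_0 (v : C) : 0 < Re (v * v)%C -> v <> RtoC 0.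
Proof. intros H E; rewrite E in H; simpl in H; lra. Qed.

Lemma int_hermite_pair_step (u v : C) (m n : nat) (l : C) :
  0 < Re (v * v)%C -> int_line_C (hermite_pair u v m n) l ->
  int_line_C (hermite_pair u v (S m) (S n)) (RtoC (2 * INR (S m)) * u / v * l)%C.
Proof.
intros Hv Hl; assert (Hv0 := Re_sqr_pos_ne_0 v Hv).
(* Adding [2 (m+1) u / v] times the known integral to [- 1 / v] times the vanishing one cancels the
   lower pair, so convergence of the raised integral comes together with its value. *)
assert (H := int_line_C_plus _ _ _ _
  (int_line_C_scal _ (- / v)%C _ (int_line_C_derive_hermite_pair u v m n Hv))
  (int_line_C_scal _ (RtoC (2 * INR (S m)) * u / v)%C _ Hl)).
replace (RtoC (2 * INR (S m)) * u / v * l)%C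
  with (- / v * RtoC 0 + RtoC (2 * INR (S m)) * u / v * l)%C by ring.
eapply int_line_C_ext; [ | exact H].
intros x; cbv beta; field; exact Hv0.
Qed.

Lemma int_hermite_pair_diag (u v : C) (n : nat) (l : C) :
  0 < Re (v * v)%C -> int_line_C (gauss (v * v)) l ->
  int_line_C (hermite_pair u v n n) (RtoC (INR (fact n) * 2 ^ n) * (u / v) ^ n * l)%C.
Proof.
intros Hv Hl; assert (Hv0 := Re_sqr_pos_ne_0 v Hv).
induction n as [ | n IH].
- replace (RtoC (INR (fact 0) * 2 ^ 0) * (u / v) ^ 0 * l)%C with l
    by (simpl; rewrite Rmult_1_l; ring).
  eapply int_line_C_ext; [ | exact Hl].
  intros x; unfold hermite_pair; simpl; ring.
- assert (H := int_hermite_pair_step u v n n _ Hv IH).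
  replace (RtoC (INR (fact (S n)) * 2 ^ S n) * (u / v) ^ S n * l)%C
    with (RtoC (2 * INR (S n)) * u / v * (RtoC (INR (fact n) * 2 ^ n) * (u / v) ^ n * l))%C;
    [exact H | ].
  rewrite fact_simpl, mult_INR, <- tech_pow_Rmult, Cpow_S, !RtoC_mult; unfold Cdiv; ring.
Qed.

(** * Nonvanishing of the complex Gaussian integral *)

Lemma RInt_even (f : R -> R) (t : R) :
  (forall x, continuous f x) -> (forall x, f (- x) = f x) ->
  RInt f (- t) t = 2 * RInt f 0 t.
Proof.
intros Hc He.
rewrite <- (RInt_Chasles f (- t) 0 t) by apply (ex_RInt_cont _ _ _ Hc).
assert (E : RInt f (- t) 0 = RInt f 0 t); [ | rewrite E; unfold plus; simpl; ring].
assert (H : is_RInt (fun y => opp (f (- y))) t 0 (RInt f (- t) 0)).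
{ apply (is_RInt_comp_opp (V := R_NormedModule)); rewrite Ropp_0.
  apply (is_RInt_cont _ _ _ Hc). }
symmetry; apply (is_RInt_unique (V := R_CompleteNormedModule)).
rewrite <- (opp_opp (RInt f (- t) 0)).
apply (is_RInt_ext (fun y => opp (opp (f (- y))))).
  intros x _; now rewrite opp_opp.
apply (is_RInt_swap (V := R_NormedModule)), (is_RInt_opp (V := R_NormedModule)), H.
Qed.

(** Since the integral over the half-line vanishes, the integral up to [x] is minus the tail. On the
    tail [t >= 1], so [exp (- a t^2) <= t exp (- a t^2)], which has an elementary primitive. *)
Lemma RInt_gauss_tail (g : R -> R) (a : R) : 0 < a ->
  (forall x, continuous g x) -> (forall t, Rabs (g t) <= exp (- (a * t ^ 2))) ->
  is_lim (RInt g 0) p_infty 0 ->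
  forall x, 1 <= x -> Rabs (RInt g 0 x) <= exp (- (a * x ^ 2)) / (2 * a).
Proof.
intros Ha Hc Hg Hlim x Hx.
assert (H : forall y, x <= y -> Rabs (RInt g 0 y - RInt g 0 x) <= exp (- (a * x ^ 2)) / (2 * a)).
{ intros y Hy.
  replace (RInt g 0 y - RInt g 0 x) with (RInt g x y).
  2: { generalize (RInt_Chasles g 0 x y (ex_RInt_cont _ _ _ Hc) (ex_RInt_cont _ _ _ Hc)).
       unfold plus; simpl; lra. }
  apply Rle_trans with (- exp (- (a * y ^ 2)) / (2 * a) - - exp (- (a * x ^ 2)) / (2 * a)).
  - apply (norm_RInt_le g (fun t => t * exp (- (a * t ^ 2))) x y); [exact Hy | | | ].
    + intros t Ht; eapply Rle_trans; [apply Hg | ].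
      generalize (exp_pos (- (a * t ^ 2))); nra.
    + apply (is_RInt_cont _ _ _ Hc).
    + apply (is_RInt_derive (fun t => - exp (- (a * t ^ 2)) / (2 * a))).
        intros t _; auto_derive; [easy | simpl; field; lra].
      intros t _; apply (ex_derive_continuous (fun t => t * exp (- (a * t ^ 2)))).
      auto_derive; easy.
  - assert (0 < exp (- (a * y ^ 2)) / (2 * a)) by (apply Rdiv_lt_0_compat; [apply exp_pos | lra]).
    unfold Rdiv in *; lra. }
assert (L : is_lim (fun y => Rabs (RInt g 0 y - RInt g 0 x)) p_infty (Rabs (RInt g 0 x))).
{ replace (Rabs (RInt g 0 x)) with (Rabs (0 - RInt g 0 x))
    by (rewrite Rminus_0_l; apply Rabs_Ropp).
  apply (is_lim_comp_continuous (fun y => RInt g 0 y - RInt g 0 x) Rabs);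
    [ | apply continuous_Rabs].
  apply is_lim_minus'; [exact Hlim | apply is_lim_const]. }
change (Rbar_le (Rabs (RInt g 0 x)) (exp (- (a * x ^ 2)) / (2 * a))).
apply (is_lim_le_loc (fun y => Rabs (RInt g 0 y - RInt g 0 x))
  (fun _ => exp (- (a * x ^ 2)) / (2 * a)) p_infty).
- exists x; intros y Hy; apply H; lra.
- exact L.
- apply is_lim_const.
Qed.

(* For [w = a + i b] and [p + i q = int_0^x exp (- w t^2) dt], the function
   [psi x = exp (w x^2 / 2) (p + i q)] solves [psi'' = (w + w^2 x^2) psi] and the flux is
   [Re (conj w * psi' * conj psi)]. It vanishes at [0] and increases strictly, whereas it would
   tend to [0] at infinity if the Gaussian integral were zero. *)
Definition flux (a b : R) (p q : R -> R) (x : R) : R :=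
  (a * cos (b * x ^ 2) - b * sin (b * x ^ 2)) * p x
  - (a * sin (b * x ^ 2) + b * cos (b * x ^ 2)) * q x
  + (a ^ 2 + b ^ 2) * x * exp (a * x ^ 2) * (p x ^ 2 + q x ^ 2).

Lemma flux_increasing (a b : R) (p q : R -> R) : 0 < a ->
  (forall x, is_derive p x (exp (- (a * x ^ 2)) * cos (b * x ^ 2))) ->
  (forall x, is_derive q x (- (exp (- (a * x ^ 2)) * sin (b * x ^ 2)))) ->
  forall x y, x < y -> flux a b p q x < flux a b p q y.
Proof.
intros Ha Hp Hq x y Hxy.
(* With [w = a + i b], the derivative is [a |psi'|^2 + |w|^2 (1 + a x^2) |psi|^2], by the equation
   for [psi]. *)
apply (incr_function _ m_infty p_infty (fun x =>
  a * exp (a * x ^ 2) * ((exp (- (a * x ^ 2)) * cos (b * x ^ 2) + x * (a * p x - b * q x)) ^ 2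
     + (- (exp (- (a * x ^ 2)) * sin (b * x ^ 2)) + x * (a * q x + b * p x)) ^ 2)
  + (a ^ 2 + b ^ 2) * (1 + a * x ^ 2) * exp (a * x ^ 2) * (p x ^ 2 + q x ^ 2)));
  try easy; clear x y Hxy; intros x _ _.
- unfold flux; auto_derive.
    repeat split; [eexists; apply Hp | eexists; apply Hq | eexists; apply Hp | eexists; apply Hq].
  replace (Derive (fun x0 : R => p x0) x) with (exp (- (a * x ^ 2)) * cos (b * x ^ 2))
    by (symmetry; apply is_derive_unique, Hp).
  replace (Derive (fun x0 : R => q x0) x) with (- (exp (- (a * x ^ 2)) * sin (b * x ^ 2)))
    by (symmetry; apply is_derive_unique, Hq).
  replace (x * (x * 1)) with (x ^ 2) by reflexivity.
  assert (E : exp (a * x ^ 2) * exp (- (a * x ^ 2)) = 1)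
    by (rewrite <- exp_plus, Rplus_opp_r; apply exp_0).
  revert E.
  generalize (exp (a * x ^ 2)) (exp (- (a * x ^ 2))) (cos (b * x ^ 2))
    (sin (b * x ^ 2)) (p x) (q x).
  intros X Y c s p0 q0 E.
  apply Rminus_diag_uniq.
  (* As polynomials, the two expressions for the derivative differ by a multiple of [1 - X * Y],
     which is zero. *)
  transitivity ((1 - X * Y) * (a * Y * (c ^ 2 + s ^ 2)
    - 2 * x * (b ^ 2 * (p0 * c - q0 * s) + a * b * (c * q0 + s * p0)))).
    ring.
  rewrite E; ring.
- assert (HX := exp_pos (a * x ^ 2)).
  destruct (Rle_lt_or_eq_dec 0 (p x ^ 2 + q x ^ 2)) as [H | H]; [nra | | ].
  (* Where [psi] is nonzero the second summand is positive; where it vanishes, [psi'] does not, and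
     the first summand is positive. *)
  + apply Rlt_gt, Rplus_le_lt_0_compat.
      apply Rmult_le_pos; [nra | ].
      apply Rplus_le_le_0_compat; apply pow2_ge_0.
    repeat apply Rmult_lt_0_compat; nra.
  + assert (p x = 0) as -> by nra.
    assert (q x = 0) as -> by nra.
    replace (_ + _) with (a * exp (a * x ^ 2) * exp (- (a * x ^ 2)) ^ 2
      * (Rsqr (sin (b * x ^ 2)) + Rsqr (cos (b * x ^ 2)))) by (unfold Rsqr; ring).
    rewrite sin2_cos2, Rmult_1_r.
    apply Rmult_lt_0_compat; [nra | apply pow_lt, exp_pos].
Qed.

(** If the integral were zero, the tail bounds would force the flux below [K / (a x)], although it
    increases strictly from [0]. *)
Lemma gauss_int_ne_0 (w l : C) : 0 < Re w -> int_line_C (gauss w) l -> l <> RtoC 0.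
Proof.
destruct w as [a b]; simpl Re; intros Ha [H1 H2] ->.
set (f := fun x => exp (- (a * x ^ 2)) * cos (b * x ^ 2)).
set (g := fun x => - (exp (- (a * x ^ 2)) * sin (b * x ^ 2))).
assert (Hf : forall x, Re (gauss (a, b) x) = f x) by (intros; now rewrite gauss_components).
assert (Hg : forall x, Im (gauss (a, b) x) = g x) by (intros; now rewrite gauss_components).
apply (int_line_ext _ f) in H1; [ | exact Hf].
apply (int_line_ext _ g) in H2; [ | exact Hg].
assert (Cf : forall x, continuous f x).
{ intros x; apply (ex_derive_continuous f); unfold f; auto_derive; easy. }
assert (Cg : forall x, continuous g x).
{ intros x; apply (ex_derive_continuous g); unfold g; auto_derive; easy. }
assert (Bf : forall t, Rabs (f t) <= exp (- (a * t ^ 2))).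
{ intros t; assert (G := Cmod_gauss (a, b) t); simpl Re in G.
  rewrite <- Hf, <- G; apply Re_le_Cmod. }
assert (Bg : forall t, Rabs (g t) <= exp (- (a * t ^ 2))).
{ intros t; assert (G := Cmod_gauss (a, b) t); simpl Re in G.
  rewrite <- Hg, <- G; apply Im_le_Cmod. }
(* By evenness a zero integral over the line gives a zero integral over the half-line. *)
assert (half : forall h : R -> R, (forall x, continuous h x) -> (forall x, h (- x) = h x) ->
  int_line h 0 -> is_lim (RInt h 0) p_infty 0).
{ intros h Ch Eh Hh.
  apply (is_lim_ext (fun t => / 2 * RInt h (- t) t)).
    intros t; rewrite (RInt_even h t Ch Eh); field.
  replace (Finite 0) with (Rbar_mult (/ 2) 0) by (simpl; apply f_equal; ring).
  apply is_lim_scal_l, int_line_sym_lim, Hh. }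
assert (sq : forall x, (- x) ^ 2 = x ^ 2) by (intros; ring).
assert (Tf := RInt_gauss_tail f a Ha Cf Bf (half f Cf (fun x => ltac:(unfold f; now rewrite sq)) H1)).
assert (Tg := RInt_gauss_tail g a Ha Cg Bg (half g Cg (fun x => ltac:(unfold g; now rewrite sq)) H2)).
assert (D : forall (h : R -> R), (forall x, continuous h x) -> forall x, is_derive (RInt h 0) x (h x)).
{ intros h Ch x; apply (is_derive_RInt h (RInt h 0) 0 x); [ | apply Ch].
  apply filter_forall; intros y; apply is_RInt_cont, Ch. }
assert (Inc := flux_increasing a b (RInt f 0) (RInt g 0) Ha (D f Cf) (D g Cg)).
set (Q := flux a b (RInt f 0) (RInt g 0)) in *.
assert (Q0 : Q 0 = 0).
{ unfold Q, flux; rewrite !RInt_point; unfold zero; simpl; ring. }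
(* The first summand bounds the terms of the flux linear in [p], [q], the second the quadratic term,
   both in units of [x exp (- a x^2)]. *)
set (K := (a + Rabs b) / a + (a ^ 2 + b ^ 2) / (2 * a ^ 2)).
assert (HK : 0 <= K).
{ apply Rplus_le_le_0_compat; apply Rdiv_le_0_compat;
    [generalize (Rabs_pos b) | | | ]; nra. }
assert (decay : forall x, 1 <= x -> Q x <= K * / (a * x)).
{ intros x Hx; specialize (Tf x Hx); specialize (Tg x Hx).
  assert (E : exp (a * x ^ 2) * exp (- (a * x ^ 2)) = 1)
    by (rewrite <- exp_plus, Rplus_opp_r; apply exp_0).
  assert (HX := exp_ineq1_le (a * x ^ 2)).
  assert (HY := exp_pos (- (a * x ^ 2))).
  assert (trig : forall k m, Rabs k <= 1 -> Rabs m <= 1 -> Rabs (a * k + b * m) <= a + Rabs b).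
  { intros k m Hk Hm; eapply Rle_trans; [apply Rabs_triang | ].
    rewrite !Rabs_mult, (Rabs_pos_eq a) by lra.
    generalize (Rabs_pos b); nra. }
  assert (Hs : Rabs (sin (b * x ^ 2)) <= 1) by (apply Rabs_le, SIN_bound).
  assert (Hc : Rabs (cos (b * x ^ 2)) <= 1) by (apply Rabs_le, COS_bound).
  assert (T1 := trig _ (- sin (b * x ^ 2)) Hc ltac:(now rewrite Rabs_Ropp)).
  assert (T2 := trig _ _ Hs Hc).
  unfold Q, flux.
  revert E HX HY Tf Tg T1 T2.
  generalize (exp (a * x ^ 2)) (exp (- (a * x ^ 2))) (cos (b * x ^ 2))
    (sin (b * x ^ 2)) (RInt f 0 x) (RInt g 0 x).
  intros X Y c s p q E HX HY Hp Hq T1 T2.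
  (* This is [a x^2 Y <= X Y = 1], from [1 + a x^2 <= X]. *)
  assert (xY : x * Y <= / (a * x)).
  { apply (Rmult_le_reg_l (a * x)); [nra | rewrite Rinv_r by nra; nra]. }
  apply Rle_trans with (K * (x * Y)).
  2: { apply Rmult_le_compat_l; [exact HK | exact xY]. }
  assert (prod : forall u v, Rabs u <= a + Rabs b -> Rabs v <= Y / (2 * a) ->
    Rabs (u * v) <= (a + Rabs b) * (Y / (2 * a))).
  { intros u v Hu Hv; rewrite Rabs_mult; apply Rmult_le_compat; auto using Rabs_pos. }
  assert (P1 := Rle_trans _ _ _ (Rle_abs _) (prod _ _ T1 Hp)).
  assert (P2 := prod _ _ T2 Hq); rewrite <- Rabs_Ropp in P2.
  assert (P2' := Rle_trans _ _ _ (Rle_abs _) P2).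
  assert (S1 : p ^ 2 <= (Y / (2 * a)) ^ 2).
  { rewrite <- (pow2_abs p); apply pow_incr; split; [apply Rabs_pos | exact Hp]. }
  assert (S2 : q ^ 2 <= (Y / (2 * a)) ^ 2).
  { rewrite <- (pow2_abs q); apply pow_incr; split; [apply Rabs_pos | exact Hq]. }
  assert (HN : 0 <= (a ^ 2 + b ^ 2) * x * X) by (apply Rmult_le_pos; nra).
  assert (P3 := Rmult_le_compat_l _ _ _ HN (Rplus_le_compat _ _ _ _ S1 S2)).
  replace ((a ^ 2 + b ^ 2) * x * X * ((Y / (2 * a)) ^ 2 + (Y / (2 * a)) ^ 2))
    with ((a ^ 2 + b ^ 2) / (2 * a ^ 2) * (x * Y) * (X * Y)) in P3 by (field; lra).
  rewrite E, Rmult_1_r in P3.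
  assert (P4 : (a + Rabs b) / a * Y <= (a + Rabs b) / a * (x * Y)).
  { apply Rmult_le_compat_l; [ | nra].
    apply Rdiv_le_0_compat; [generalize (Rabs_pos b); lra | lra]. }
  replace ((a + Rabs b) * (Y / (2 * a))) with ((a + Rabs b) / a * Y / 2) in P1, P2' by (field; lra).
  unfold K; lra. }
assert (HQ1 : 0 < Q 1) by (rewrite <- Q0; apply Inc; lra).
(* Chosen so that [a x Q 1 = 2 a Q 1 + K > K], against [Q 1 < Q x <= K / (a x)]. *)
set (x := 2 + K / (a * Q 1)).
assert (Hx : 2 <= x).
{ assert (0 <= K / (a * Q 1)) by (apply Rdiv_le_0_compat; [exact HK | nra]).
  unfold x; lra. }
assert (L1 := Inc 1 x ltac:(lra)).
assert (L2 := decay x ltac:(lra)).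
assert (L3 : Q 1 * (a * x) < K).
{ replace K with (K * / (a * x) * (a * x)) by (field; split; lra).
  apply Rmult_lt_compat_r; nra. }
revert L3; apply Rle_not_lt.
replace (Q 1 * (a * x)) with (2 * (a * Q 1) + K) by (unfold x; field; split; lra).
nra.
Qed.

Lemma gauss_RtoC (a x : R) : gauss (RtoC a) x = RtoC (exp (- (a * x ^ 2))).
Proof.
unfold RtoC; rewrite gauss_components, Rmult_0_l, cos_0, sin_0.
apply f_equal2; ring.
Qed.

(** * The lower bound for the projection norms *)

(** Realness of [H_n (s x)] turns the conjugate products in the expanded square below into the
    bilinear integrands already evaluated. *)
Lemma Im_hermite_RtoC (n : nat) (x : R) : Im (hermite n (RtoC x)) = 0.
Proof.
enough (H : Im (hermite n (RtoC x)) = 0 /\ Im (hermite (S n) (RtoC x)) = 0) by apply H.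
induction n as [ | n [IH1 IH2]]; split.
- reflexivity.
- simpl; ring.
- exact IH2.
- rewrite hermite_SS; revert IH1 IH2.
  generalize (hermite n (RtoC x)) (hermite (S n) (RtoC x)).
  intros [p1 q1] [p2 q2]; simpl; intros -> ->; ring.
Qed.

Lemma RtoC_sqr_sqrt (a : R) : 0 <= a -> (RtoC (sqrt a) * RtoC (sqrt a))%C = RtoC a.
Proof. intros Ha; rewrite <- RtoC_mult, sqrt_sqrt; auto. Qed.

(** Positivity combines the sign of the integrand with the nonvanishing of the Gaussian integral. *)
Lemma gauss_real_int_pos (a : R) : 0 < a ->
  exists g, 0 < g /\ int_line_C (gauss (RtoC a)) (RtoC g).
Proof.
intros Ha.
destruct (ex_int_line_C_gauss (RtoC a) (fun _ => RtoC 1)) as [[g i] Hl].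
- exact Ha.
- exact (continuous_RC_mult _ _ (continuous_RC_gauss _) (continuous_RC_const _)).
- apply poly_bounded_const.
- apply (int_line_C_ext _ (gauss (RtoC a))) in Hl; [ | intros x; apply Cmult_1_r].
  assert (Hne := gauss_int_ne_0 (RtoC a) (g, i) Ha Hl).
  assert (Hre : forall x, Re (gauss (RtoC a) x) = exp (- (a * x ^ 2))).
  { intros x; now rewrite gauss_RtoC. }
  (* The imaginary part is its own multiple by [0], so by uniqueness its integral satisfies
     [i = 0 * i]. *)
  assert (Him : forall x, 0 * Im (gauss (RtoC a) x) = Im (gauss (RtoC a) x)).
  { intros x; rewrite gauss_RtoC; simpl; ring. }
  assert (Hi : i = 0).
  { assert (H0 := int_line_ext _ _ _ Him (int_line_scal _ 0 _ (proj2 Hl))).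
    assert (E := int_line_unique _ _ _ (proj2 Hl) H0); simpl in E; lra. }
  subst i; exists g; split; [ | exact Hl].
  assert (0 <= g).
  { apply (int_line_ge_0 (fun x => Re (gauss (RtoC a) x))); [ | | apply Hl].
      intros x; apply (continuous_RC_gauss (RtoC a) x).
    intros x; rewrite Hre; apply Rlt_le, exp_pos. }
  destruct (Req_dec g 0) as [E | E]; [ | lra].
  now rewrite E in Hne; elim Hne.
Qed.

(** This is [|g_n (x)|^2]: the factor [exp (- z^2 x^2 / 2)] has modulus
    [exp (- Re (z^2) x^2 / 2)]. *)
Definition weighted_sq (z : C) (n : nat) (x : R) : R :=
  exp (- (Re (z * z)%C * x ^ 2)) * Cmod (hermite n (z * RtoC x)) ^ 2.

Lemma weighted_sq_Re (z : C) (n : nat) (x : R) :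
  weighted_sq z n x = Re (gauss (RtoC (Re (z * z)%C)) x
    * (hermite n (z * RtoC x) * Cconj (hermite n (z * RtoC x))))%C.
Proof.
unfold weighted_sq; rewrite gauss_RtoC, <- Cmod2_conj, <- RtoC_mult; reflexivity.
Qed.

Lemma ex_int_weighted_sq (z : C) (n : nat) :
  0 < Re (z * z)%C -> exists A, int_line (weighted_sq z n) A.
Proof.
intros Ha.
destruct (ex_int_line_C_gauss (RtoC (Re (z * z)%C))
  (fun x => hermite n (z * RtoC x) * Cconj (hermite n (z * RtoC x)))%C) as [l Hl].
- exact Ha.
- exact (continuous_RC_mult _ _ (continuous_RC_gauss _) (continuous_RC_mult _ _
    (continuous_RC_hermite z n) (continuous_RC_conj _ (continuous_RC_hermite z n)))).
- destruct (poly_bounded_hermite z n) as [K [k [HK Hk]]].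
  apply poly_bounded_mult; exists K, k; split; auto.
  intros x; rewrite Cmod_conj; apply Hk.
- exists (Re l); eapply int_line_ext; [ | apply Hl].
  intros x; symmetry; apply weighted_sq_Re.
Qed.

(** Bessel's inequality in the space with weight [exp (- a x^2)], for [H_n (z x)] against the single
    real function [H_n (s x)]. *)
Lemma int_weighted_sq_ge (z : C) (n : nat) (A g : R) :
  0 < Re (z * z)%C -> int_line (weighted_sq z n) A ->
  int_line_C (gauss (RtoC (Re (z * z)%C))) (RtoC g) ->
  (Cmod z ^ 2 / Re (z * z)%C) ^ n * (INR (fact n) * 2 ^ n * g) <= A.
Proof.
intros Ha HA Hg.
set (a := Re (z * z)%C) in *.
set (s := RtoC (sqrt a)).
assert (Hs : (s * s)%C = RtoC a) by (apply RtoC_sqr_sqrt; lra).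
assert (Hs0 : s <> RtoC 0).
{ apply Re_sqr_pos_ne_0; rewrite Hs; exact Ha. }
(* The quotient of the diagonal integrals for [(z, s)] and [(s, s)], so [k H_n (s x)] is the
   orthogonal projection of [H_n (z x)]. *)
set (k := ((z / s) ^ n)%C).
assert (Hk : Cmod k ^ 2 = (Cmod z ^ 2 / a) ^ n).
{ unfold k; rewrite Cmod_pow, <- pow_mult, Nat.mul_comm, pow_mult; f_equal.
  rewrite Cmod_div by exact Hs0.
  unfold s; rewrite Cmod_R, (Rabs_pos_eq _ (sqrt_pos a)).
  unfold Rdiv; rewrite Rpow_mult_distr, pow_inv.
  now rewrite pow2_sqrt by lra. }
rewrite <- Hk.
set (N := INR (fact n) * 2 ^ n).
rewrite <- Hs in Hg.
assert (H1 := int_hermite_pair_diag z s n _ ltac:(rewrite Hs; exact Ha) Hg).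
assert (H2 := int_hermite_pair_diag s s n _ ltac:(rewrite Hs; exact Ha) Hg).
fold N k in H1, H2.
replace (RtoC N * (s / s) ^ n * RtoC g)%C with (RtoC (N * g)) in H2.
2: { unfold Cdiv; rewrite Cinv_r, Cpow_1_l, RtoC_mult by exact Hs0; ring. }
replace (RtoC N * k * RtoC g)%C with (k * RtoC (N * g))%C in H1 by (rewrite RtoC_mult; ring).
(* The integrated square: [A - 2 |k|^2 N g + |k|^2 N g]. *)
assert (H := int_line_plus _ _ _ _ HA (int_line_plus _ _ _ _
  (proj1 (int_line_C_scal _ (RtoC (- 2) * Cconj k)%C _ H1))
  (proj1 (int_line_C_scal _ (RtoC (Cmod k ^ 2)) _ H2)))).
assert (Hsq : forall x, Cmod (hermite n (z * RtoC x) - k * hermite n (s * RtoC x)) ^ 2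
  * exp (- (a * x ^ 2)) =
  weighted_sq z n x + (Re (RtoC (- 2) * Cconj k * hermite_pair z s n n x)%C
    + Re (RtoC (Cmod k ^ 2) * hermite_pair s s n n x)%C)).
{ intros x; unfold weighted_sq, hermite_pair; rewrite Hs; fold a.
  rewrite gauss_RtoC; generalize (exp (- (a * x ^ 2))); intros e.
  assert (Him := Im_hermite_RtoC n (sqrt a * x)).
  rewrite RtoC_mult in Him; fold s in Him; revert Him.
  generalize (hermite n (z * RtoC x)%C) (hermite n (s * RtoC x)%C) k.
  intros [h1 h2] [q1 q2] [k1 k2]; unfold Im at 1; simpl snd; intros ->.
  rewrite !Cmod2_alt; simpl; ring. }
assert (Hpos : 0 <= A + (Re (RtoC (- 2) * Cconj k * (k * RtoC (N * g)))%C
  + Re (RtoC (Cmod k ^ 2) * RtoC (N * g))%C)).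
{ refine (int_line_ge_0 _ _ _ _ H).
  - intros x.
    apply (continuous_plus (weighted_sq z n)); [ | apply @continuous_plus].
    + apply (continuous_ext (fun t => Re (gauss (RtoC a) t
        * (hermite n (z * RtoC t) * Cconj (hermite n (z * RtoC t))))%C)).
        intros t; symmetry; apply weighted_sq_Re.
      exact (proj1 (continuous_RC_mult _ _ (continuous_RC_gauss _) (continuous_RC_mult _ _
        (continuous_RC_hermite z n) (continuous_RC_conj _ (continuous_RC_hermite z n))) x)).
    + exact (proj1 (continuous_RC_mult _ _ (continuous_RC_const _) (continuous_RC_hermite_pair z s n n) x)).
    + exact (proj1 (continuous_RC_mult _ _ (continuous_RC_const _) (continuous_RC_hermite_pair s s n n) x)).
  - intros x; rewrite <- Hsq.
    apply Rmult_le_pos; [apply pow2_ge_0 | apply Rlt_le, exp_pos]. }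
revert Hpos; generalize (N * g) k; intros m [k1 k2].
rewrite !Cmod2_alt; simpl; lra.
Qed.

(** * From the eigenfunctions to the Hermite integrals *)

Lemma cexp_plus (u v : C) : cexp (u + v)%C = (cexp u * cexp v)%C.
Proof.
destruct u, v; unfold cexp, Cmult; simpl; rewrite exp_plus, cos_plus, sin_plus.
apply f_equal2; ring.
Qed.

Lemma gfun_sq (r theta : R) (n : nat) (x : R) :
  (gfun r theta n x * gfun r theta n x)%C
  = hermite_pair (zpar r theta) (zpar r theta) n n x.
Proof.
unfold gfun, hermite_pair, gauss; set (z := zpar r theta).
replace (RtoC (- x ^ 2) * (z * z))%C
  with (RtoC (- x ^ 2 / 2) * (z * z) + RtoC (- x ^ 2 / 2) * (z * z))%C.
  rewrite cexp_plus; ring.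
rewrite <- Cmult_plus_distr_r, <- RtoC_plus; do 2 f_equal; field.
Qed.

Lemma Cmod_gfun_sq (r theta : R) (n : nat) (x : R) :
  Cmod (gfun r theta n x) ^ 2 = weighted_sq (zpar r theta) n x.
Proof.
replace (Cmod (gfun r theta n x) ^ 2) with (Cmod (gfun r theta n x * gfun r theta n x)%C)
  by (rewrite Cmod_mult; ring).
rewrite gfun_sq; unfold hermite_pair, weighted_sq.
rewrite !Cmod_mult, Cmod_gauss; ring.
Qed.

Lemma Re_zpar_sq (r theta : R) :
  Re (zpar r theta * zpar r theta)%C = r ^ 2 * cos (2 * theta).
Proof. rewrite cos_2a; simpl; ring. Qed.

Lemma Cmod_zpar_sq (r theta : R) : Cmod (zpar r theta) ^ 2 = r ^ 2.
Proof.
rewrite Cmod2_alt; simpl.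
replace (_ + _) with (r ^ 2 * (Rsqr (sin theta) + Rsqr (cos theta))) by (unfold Rsqr; ring).
rewrite sin2_cos2; ring.
Qed.

(** The numerator of [normP] is at least [(sec (2 theta))^n n! 2^n g] and its denominator equals
    [n! 2^n |l|]; the growth of the factorial cancels. *)
Lemma normP_ge (r theta : R) : 0 < r -> 0 < cos (2 * theta) ->
  exists c, 0 < c /\ forall n, c * (/ cos (2 * theta)) ^ n <= normP r theta n.
Proof.
intros hr hc; set (z := zpar r theta).
assert (Ha : 0 < Re (z * z)%C).
{ unfold z; rewrite Re_zpar_sq; apply Rmult_lt_0_compat; [apply pow_lt | ]; assumption. }
assert (Hz := Re_sqr_pos_ne_0 z Ha).
destruct (gauss_real_int_pos _ Ha) as [g [Hg HG]].
destruct (ex_int_line_C_gauss (z * z)%C (fun _ => RtoC 1)) as [l Hl].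
- exact Ha.
- exact (continuous_RC_mult _ _ (continuous_RC_gauss _) (continuous_RC_const _)).
- apply poly_bounded_const.
- apply (int_line_C_ext _ (gauss (z * z))) in Hl; [ | intros x; apply Cmult_1_r].
  assert (Hl0 : 0 < Cmod l) by (apply Cmod_gt_0, (gauss_int_ne_0 _ _ Ha Hl)).
  (* The ratio of the Gaussian integrals with parameters [Re (z^2)] and [z^2], independent of
     [n]. *)
  exists (g / Cmod l); split; [apply Rdiv_lt_0_compat; assumption | ].
  intros n.
  destruct (ex_int_weighted_sq z n Ha) as [A HA].
  assert (HN : 0 < INR (fact n) * 2 ^ n).
  { apply Rmult_lt_0_compat; [apply INR_fact_lt_0 | apply pow_lt; lra]. }
  assert (EA : int_R (fun x => Cmod (gfun r theta n x) ^ 2) = A).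
  { apply int_R_of_int_line; eapply int_line_ext; [ | exact HA].
    intros x; symmetry; apply Cmod_gfun_sq. }
  destruct (int_hermite_pair_diag z z n l Ha Hl) as [D1 D2].
  assert (ED : int_R (V := C_R_CompleteNormedModule)
    (fun x => Cmult (gfun r theta n x) (gfun r theta n x))
    = (RtoC (INR (fact n) * 2 ^ n) * (z / z) ^ n * l)%C).
  { apply int_R_of_int_line_C.
    - eapply int_line_ext; [ | exact D1]; intros x; cbv beta; now rewrite gfun_sq.
    - eapply int_line_ext; [ | exact D2]; intros x; cbv beta; now rewrite gfun_sq. }
  unfold normP; rewrite EA, ED.
  unfold Cdiv; rewrite Cinv_r, Cpow_1_l, Cmult_1_r, Cmod_mult, Cmod_R by exact Hz.
  rewrite Rabs_pos_eq by lra.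
  assert (HB := int_weighted_sq_ge z n A g Ha HA HG).
  unfold z in HB; rewrite Cmod_zpar_sq, Re_zpar_sq in HB.
  replace (r ^ 2 / (r ^ 2 * cos (2 * theta))) with (/ cos (2 * theta)) in HB
    by (field; lra).
  apply (Rmult_le_reg_r (INR (fact n) * 2 ^ n * Cmod l)); [apply Rmult_lt_0_compat; lra | ].
  unfold Rdiv at 2; rewrite (Rmult_assoc A), Rinv_l, Rmult_1_r.
  2: { apply Rgt_not_eq, Rmult_lt_0_compat; lra. }
  eapply Rle_trans; [ | exact HB]; apply Req_le; field; lra.
Qed.

Theorem theorem7 (r theta : R) (hr : 0 < r) (htheta : Rabs theta < PI / 4) :
  Rbar_le (Finite (ln (/ cos (2 * theta))))
          (LimInf_seq (fun n : nat => / INR n * ln (normP r theta n))).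
Proof.
assert (hc : 0 < cos (2 * theta)).
{ apply Rabs_def2 in htheta; apply cos_gt_0; lra. }
destruct (normP_ge r theta hr hc) as [c [Hc Hn]].
set (s := / cos (2 * theta)) in *.
assert (Hs : 0 < s) by (apply Rinv_0_lt_compat, hc).
(* The logarithm of [c s^n] divided by [n]; the constant [c] disappears in the limit. *)
assert (L : LimInf_seq (fun n => ln c * / INR n + ln s) = Finite (ln s)).
{ apply is_LimInf_seq_unique, is_lim_LimInf_seq.
  replace (Finite (ln s)) with (Finite (ln c * 0 + ln s)) by (apply f_equal; ring).
  apply is_lim_seq_plus'; [ | apply is_lim_seq_const].
  apply (is_lim_seq_scal_l (fun n => / INR n) (ln c) 0).
  apply (is_lim_seq_inv INR p_infty); [apply is_lim_seq_INR | easy]. }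
rewrite <- L.
(* The comparison starts at [n = 1], since [/ INR 0] is only a default value. *)
apply LimInf_le; exists 1%nat; intros n Hn1.
assert (Hn0 : 0 < INR n) by (apply lt_0_INR; lia).
apply Rle_trans with (/ INR n * ln (c * s ^ n)).
- rewrite ln_mult, ln_pow by (try apply pow_lt; assumption).
  apply Req_le; field; lra.
- apply Rmult_le_compat_l; [apply Rlt_le, Rinv_0_lt_compat, Hn0 | ].
  apply ln_le; [ | apply Hn].
  apply Rmult_lt_0_compat; [ | apply pow_lt]; assumption.
Qed.
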